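(* Let $n,m,j\in\mathbb{Z}^+$ with $m\ge3$ and $1\le j<m/2$, and let $G(m,j)$ be the generalized Petersen graph. Then: (1) if $4\nmid n$, then $\chi_{n,1}(G(m,j))$ exists; (2) if $4\mid n$ and $2\nmid m$, then $\chi_{n,1}(G(m,j))$ does not exist; (3) if $4\mid n$, $2\mid m$ and $2\nmid j$, then $\chi_{n,1}(G(m,j))$ exists if and only if $4\mid m$; (4) if $4\mid n$, $8\nmid n$, $2\mid m$ and $2\mid j$, then $\chi_{n,1}(G(m,j))$ exists; (5) if $8\mid n$, $2\mid m$, $4\nmid m$ and $2\mid j$, then $\chi_{n,1}(G(m,j))$ does not exist; (6) if $16\mid n$, $4\mid m$, $8\nmid m$ and $2\mid j$, then $\chi_{n,1}(G(m,j))$ does not exist.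
   Context: The generalized Petersen graph $G(m,j)$ has vertex set $\{v_i,u_i: i\in\mathbb{Z}_m\}$ and edge set $\{v_iv_{i+1}, v_iu_i, u_iu_{i+j}: i\in\mathbb{Z}_m\}$ (indices mod $m$). For a graph $G=(V,E)$, a labeling $\ell:V\to\mathbb{Z}$ is proper if adjacent vertices get distinct labels, and it is a closed coloring with remainder $k\bmod n$ if $\sum_{w\in N[v]}\ell(w)\equiv k\pmod n$ for every $v$, where $N[v]$ is the closed neighborhood of $v$. $\chi_{n,k}(G)$ exists iff a proper closed coloring with remainder $k\bmod n$ exists. *)

(* Defs.v *)
From mathcomp Require Import all_boot all_order all_algebra.

Set Implicit Arguments.
Unset Strict Implicit.
Unset Printing Implicit Defensive.

Import Order.TTheory GRing.Theory Num.Theory.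

Local Open Scope ring_scope.

(* A finite graph is given by its adjacency relation e : rel V. *)

Definition closed_nbhd (V : finType) (e : rel V) (x : V) : {set V} :=
  [set y | (y == x) || e x y].

Definition proper_labeling (V : finType) (e : rel V) (l : V -> int) : Prop :=
  forall x y : V, e x y -> l x <> l y.

Definition closed_coloring (V : finType) (e : rel V) (n : nat) (k : int)
    (l : V -> int) : Prop :=
  forall x : V, (\sum_(y in closed_nbhd e x) l y = k %[mod n%:Z])%Z.

(* Labels are integers, not residues: properness is distinctness in int, while
   only the neighborhood sums are read mod n. *)
Definition chi_exists (V : finType) (e : rel V) (n : nat) (k : int) : Prop :=
  exists l : V -> int, proper_labeling e l /\ closed_coloring e n k l.

(* inl i is the vertex v_i and inr i is the vertex u_i. The type 'Z_m is the
   ring of integers mod m only for 1 < m. *)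
Definition petersen_vertex (m : nat) : finType := ('Z_m + 'Z_m)%type.

Definition petersen_arc (m j : nat) : rel (petersen_vertex m) :=
  fun x y => match x, y with
  | inl a, inl b => b == a + 1
  | inl a, inr b => b == a
  | inr a, inr b => b == a + j%:R
  | inr _, inl _ => false
  end.

Definition petersen (m j : nat) : rel (petersen_vertex m) :=
  fun x y => petersen_arc j x y || petersen_arc j y x.
Arguments petersen m j : clear implicits.

Lemma petersen_sym (m j : nat) : symmetric (petersen m j).
Proof. by move=> x y; rewrite /petersen orbC. Qed.

Lemma petersen_irr (m j : nat) :
  (2 < m)%N -> (0 < j)%N -> (2 * j < m)%N -> irreflexive (petersen m j).
Proof.
move=> m3 j0 jm [] a; rewrite /petersen /= orbb -{1}[a]addr0.
  by rewrite (inj_eq (addrI a)) eq_sym oner_eq0.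
rewrite (inj_eq (addrI a)) eq_sym; apply/negbTE/eqP => /(congr1 val).
rewrite /= val_Zp_nat ?(ltnW m3) // modn_small; first by case: j j0 {jm}.
by apply: leq_ltn_trans jm; rewrite leq_pmull.
Qed.

(* Main.v *)
Require Import Defs.
From mathcomp Require Import all_boot all_order all_algebra.
From mathcomp Require Import zify ring.

(** Only residues matter: adding distinct multiples of [n] to the labels makes
    any closed coloring proper, so the question is whether a linear system over
    the integers mod [n] is solvable. Solutions are constant on the [v_i] and
    on the [u_i], or periodic mod 2 or mod 4 in [i]. Obstructions come from
    summing the congruences over all [i], or over the [i] of a fixed parity,
    modulo 4, 8 or 16. *)

Set Implicit Arguments.
Unset Strict Implicit.
Unset Printing Implicit Defensive.

Import GRing.Theory.

(** The rank of a vertex becomes the quotient of its new label by [n], so the new labels are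
    pairwise distinct, while their residues are those of [l]. *)
Lemma chi_existsE (V : finType) (e : rel V) (n : nat) (k : int) :
  0 < n -> irreflexive e ->
  chi_exists e n k <-> exists l, closed_coloring e n k l.
Proof.
move=> n_gt0 irr; split=> [[l [_ Hl]]|[l Hl]]; first by exists l.
have n0 : (n%:Z != 0)%R by lia.
exists (fun x => ((enum_rank x : nat)%:Z * n%:Z + (l x %% n)%Z)%R).
split=> [x y exy /(congr1 (divz^~ n))|x].
  have q0 z : ((l z %% n)%Z %/ n)%Z = 0%R.
    by rewrite divz_small // modz_ge0 // ltz_pmod // ltz_nat.
  rewrite !divzMDl // !q0 !addr0 => -[/val_inj/enum_rank_inj xy].
  by rewrite xy irr in exy.
rewrite -(Hl x); apply/eqP; rewrite eqz_mod_dvd -sumrB.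
apply: rpred_sum => y _; rewrite /modz.
by apply/dvdzP; exists ((enum_rank y : nat)%:Z - (l y %/ n)%Z)%R; ring.
Qed.

(** Subtracting the congruences gives x = y mod p, and x = y mod 2p would make 3x + y even; hence x
    = y + p. With p = 2t + 1 this leaves 2y = -(3t + 1) mod p, and t + 1 is the inverse of 2 mod
    p. *)
Lemma double_odd_system (p : nat) : odd p ->
  exists x y q r : int, (3 * x + y = 1 + q * (2 * p)%N%:Z)%R /\
                        (3 * y + x = 1 + r * (2 * p)%N%:Z)%R.
Proof.
move=> p_odd; have : p = (p./2 + p./2 + 1)%N by lia.
move: p./2 => t ->; pose y : int := (- ((t%:Z + 1) * (3 * t%:Z + 1)))%R.
exists (y + 2 * t%:Z + 1)%R, y, (- (3 * t%:Z + 1))%R, (- (3 * t%:Z + 2))%R.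
by rewrite /y; split; rewrite PoszM !PoszD; ring.
Qed.

Lemma closed_coloring_dvd (V : finType) (e : rel V) (n d : nat) (k : int) l :
  d %| n -> closed_coloring e n k l -> closed_coloring e d k l.
Proof.
move=> dn H x; have /eqP := H x; rewrite eqz_mod_dvd => nx.
by apply/eqP; rewrite eqz_mod_dvd; apply: dvdz_trans nx.
Qed.

Lemma sum_eqz_mod (I : finType) (P : pred I) (F G : I -> int) (d : int) :
  (forall i, (F i = G i %[mod d])%Z) ->
  ((\sum_(i | P i) F i)%R = (\sum_(i | P i) G i)%R %[mod d])%Z.
Proof.
move=> FG; apply/eqP; rewrite eqz_mod_dvd -sumrB; apply: rpred_sum => i _.
by rewrite -eqz_mod_dvd; apply/eqP.
Qed.

(** * Representatives and parity in ['Z_m] *)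

Lemma val_Zp_add (m : nat) (x y : 'Z_m) : 1 < m ->
  (x + y)%R = (x + y)%N %% m :> nat.
Proof. by case: m x y => [|[|m]]. Qed.

Lemma odd_Zp_add (m : nat) (x y : 'Z_m) : 1 < m -> 2 %| m ->
  odd (x + y)%R = odd x (+) odd y.
Proof. by move=> m1 m2; rewrite val_Zp_add // odd_mod ?oddD //; apply/negbTE; rewrite -dvdn2. Qed.

Lemma odd_Zp_opp (m : nat) (x : 'Z_m) : 1 < m -> 2 %| m -> odd (- x)%R = odd x.
Proof.
move=> m1 m2; have := odd_Zp_add x (- x)%R m1 m2.
by rewrite subrr; move: (odd x) (odd (- x)%R) => [] [].
Qed.

Lemma val_Zp_addn (m p c : nat) (i : 'Z_m) : 1 < m -> p %| m ->
  (i + c%:R)%R = i + c %[mod p].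
Proof. by move=> m1 pm; rewrite val_Zp_add // val_Zp_nat // modnDmr modn_dvdm. Qed.

Lemma val_Zp_subn (m p c : nat) (i : 'Z_m) : 1 < m -> p %| m ->
  (i - c%:R)%R + c = i %[mod p].
Proof. by move=> m1 pm; rewrite -val_Zp_addn // subrK. Qed.

Lemma Zp_natr_eq0 (m c : nat) : 1 < m -> (c%:R == 0 :> 'Z_m)%R = (m %| c).
Proof. by move=> m1; rewrite Zp_nat -val_eqE /= Zp_cast. Qed.

(** * Closed neighborhoods and periodic colorings of G(m,j) *)

Section Petersen.

Variables m j : nat.
Hypotheses (m_ge3 : 2 < m) (j_gt0 : 0 < j) (jm : 2 * j < m).

Let m_gt1 : 1 < m. Proof. exact: ltnW. Qed.

(** With [c] equal to 1 or [j], this makes the four members of a closed neighborhood distinct, so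
    that its sum has four separate terms. *)
Lemma addr_neq_subr (c : nat) (i : 'Z_m) : 0 < c -> 2 * c < m ->
  [&& i - c%:R != i, i != i + c%:R & i - c%:R != i + c%:R]%R.
Proof.
move=> c0 cm; apply/and3P; split.
- by rewrite -subr_eq0 addrAC subrr add0r oppr_eq0 Zp_natr_eq0 // gtnNdvd //; lia.
- by rewrite -subr_eq0 opprD addNKr oppr_eq0 Zp_natr_eq0 // gtnNdvd //; lia.
- rewrite eq_sym -subr_eq0 opprD opprK addrACA subrr add0r -natrD Zp_natr_eq0 //.
  by rewrite gtnNdvd //; lia.
Qed.

Lemma closed_nbhd_sumv (l : petersen_vertex m -> int) (i : 'Z_m) :
  (\sum_(y in closed_nbhd (petersen m j) (inl i)) l y =
   l (inl (i - 1)) + l (inl i) + l (inl (i + 1)) + l (inr i))%R.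
Proof.
have /and3P[h1 h2 h3] := addr_neq_subr i (isT : 0 < 1) m_ge3.
pose s : seq (petersen_vertex m) :=
  [:: inl (i - 1)%R; inl i; inl (i + 1)%R; inr i].
have us : uniq s by rewrite /= !inE !(inj_eq inl_inj) (negbTE h1) (negbTE h2) (negbTE h3).
transitivity (\sum_(y in s) l y)%R.
  apply: eq_bigl => -[a|a]; rewrite !inE /petersen /= ?(inj_eq inl_inj) ?(inj_eq inr_inj) /=.
    have -> : (i == a + 1 = (a == i - 1))%R by rewrite -subr_eq eq_sym.
    by do 3!case: (_ == _)%R.
  by rewrite orbF.
by rewrite -big_uniq // !big_cons big_nil /= addr0 !addrA.
Qed.

Lemma closed_nbhd_sumu (l : petersen_vertex m -> int) (i : 'Z_m) :
  (\sum_(y in closed_nbhd (petersen m j) (inr i)) l y =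
   l (inr (i - j%:R)) + l (inr i) + l (inr (i + j%:R)) + l (inl i))%R.
Proof.
have /and3P[h1 h2 h3] := addr_neq_subr i j_gt0 jm.
pose s : seq (petersen_vertex m) :=
  [:: inr (i - j%:R)%R; inr i; inr (i + j%:R)%R; inl i].
have us : uniq s by rewrite /= !inE !(inj_eq inr_inj) (negbTE h1) (negbTE h2) (negbTE h3).
transitivity (\sum_(y in s) l y)%R.
  apply: eq_bigl => -[a|a]; rewrite !inE /petersen /= ?(inj_eq inl_inj) ?(inj_eq inr_inj) /=.
    by rewrite eq_sym.
  have -> : (i == a + j%:R = (a == i - j%:R))%R by rewrite -subr_eq eq_sym.
  by do 3!case: (_ == _)%R.
by rewrite -big_uniq // !big_cons big_nil /= addr0 !addrA.
Qed.

Lemma closed_coloring_petersen (n : nat) (k : int) (l : petersen_vertex m -> int) :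
  closed_coloring (petersen m j) n k l <->
  forall i : 'Z_m,
    ((l (inl (i - 1)) + l (inl i) + l (inl (i + 1)) + l (inr i))%R = k %[mod n])%Z /\
    ((l (inr (i - j%:R)) + l (inr i) + l (inr (i + j%:R)) + l (inl i))%R
       = k %[mod n])%Z.
Proof.
split=> [H i|H [i|i]].
- by rewrite -closed_nbhd_sumv -closed_nbhd_sumu.
- by rewrite closed_nbhd_sumv; case: (H i).
- by rewrite closed_nbhd_sumu; case: (H i).
Qed.

(** Since [p] divides [m], functions of period [p] descend to ['Z_m]. The congruences are centered
    at [x + 1] and [x + j] to avoid truncated subtraction. *)
Lemma periodic_chi_exists (n p : nat) (k : int) (f g : nat -> int) :
  0 < n -> p %| m ->
  (forall x y, x = y %[mod p] -> f x = f y) ->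
  (forall x y, x = y %[mod p] -> g x = g y) ->
  (forall x, (f x + f (x + 1) + f (x + 1 + 1) + g (x + 1) = k %[mod n])%Z) ->
  (forall x, (g x + g (x + j) + g (x + j + j) + f (x + j) = k %[mod n])%Z) ->
  chi_exists (petersen m j) n k.
Proof.
move=> n0 pm fp gp Hv Hu; apply/(chi_existsE _ n0); first exact: petersen_irr.
pose l (x : petersen_vertex m) :=
  match x with inl i => f i | inr i => g i end.
exists l; apply/closed_coloring_petersen => i; split; rewrite /l.
  have pred_i := val_Zp_subn 1 i m_gt1 pm; have succ_i := val_Zp_addn 1 i m_gt1 pm.
  rewrite -(fp _ _ pred_i) -(gp _ _ pred_i) (fp _ _ succ_i) -(Hv (i - 1)%R).
  suff -> : f (i + 1) = f ((i - 1)%R + 1 + 1) by [].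
  by apply: fp; rewrite -modnDml -pred_i modnDml.
have pred_i := val_Zp_subn j i m_gt1 pm; have succ_i := val_Zp_addn j i m_gt1 pm.
rewrite -(fp _ _ pred_i) -(gp _ _ pred_i) (gp _ _ succ_i) -(Hu (i - j%:R)%R).
suff -> : g (i + j) = g ((i - j%:R)%R + j + j) by [].
by apply: gp; rewrite -modnDml -pred_i modnDml.
Qed.

Lemma constant_chi_exists (n : nat) (k f g : int) : 0 < n ->
  (3 * f + g = k %[mod n])%Z -> (3 * g + f = k %[mod n])%Z ->
  chi_exists (petersen m j) n k.
Proof.
move=> n0 Hf Hg.
apply: (@periodic_chi_exists n 1 k (fun=> f) (fun=> g)) => // _.
  by rewrite -Hf; congr (_ %% _)%Z; ring.
by rewrite -Hg; congr (_ %% _)%Z; ring.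
Qed.

(** * Sums over the indices of one parity *)

Definition vsum (l : petersen_vertex m -> int) (b : bool) : int :=
  (\sum_(i : 'Z_m | odd i == b) l (inl i))%R.
Definition usum (l : petersen_vertex m -> int) (b : bool) : int :=
  (\sum_(i : 'Z_m | odd i == b) l (inr i))%R.

Lemma sum_shift (f : 'Z_m -> int) (c : 'Z_m) (b : bool) : 2 %| m ->
  (\sum_(i : 'Z_m | odd i == b) f (i + c) =
   \sum_(i : 'Z_m | odd i == b (+) odd c) f i)%R.
Proof.
move=> m2; rewrite [RHS](reindex_inj (addIr c)) /=; apply: eq_bigl => i.
by rewrite odd_Zp_add //; do 2!case: (odd _); case: b.
Qed.

(** Translation by 1 swaps the two parity classes, so each holds half of the indices. *)
Lemma sum1_parity (b : bool) : 2 %| m ->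
  (\sum_(i : 'Z_m | odd i == b) 1 = (m./2)%:Z)%R.
Proof.
move=> m2; have shift := @sum_shift (fun=> 1%R) 1%R _ m2.
have odd1 : odd (1%R : 'Z_m) by rewrite -[1%R]mulr1n val_Zp_nat // modn_small.
have : (\sum_(i : 'Z_m | odd i == true) 1 + \sum_(i : 'Z_m | odd i == false) 1
        = m%:Z)%R.
  have <- : (\sum_(i : 'Z_m) 1 = m%:Z)%R by rewrite sumr_const card_ord Zp_cast ?natz.
  rewrite [RHS](bigID (fun i : 'Z_m => odd i)) /=.
  by congr (_ + _)%R; apply: eq_bigl => i; case: (odd i).
have := shift true; rewrite odd1 /=.
case: b; move: (\sum_(i : 'Z_m | odd i == true) 1)%R;
  by move: (\sum_(i : 'Z_m | odd i == false) 1)%R => s t; lia.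
Qed.

(** Sum the congruences over the indices of parity [b]: shifts by 1 in either direction land in the
    other class, shifts by [j] in the class [b (+) odd j]. *)
Lemma sum_parity_classes (n : nat) (l : petersen_vertex m -> int) (b : bool) :
  2 %| m -> closed_coloring (petersen m j) n 1%R l ->
  (vsum l b + 2 * vsum l (~~ b) + usum l b = (m./2)%:Z %[mod n])%Z /\
  (usum l b + 2 * usum l (b (+) odd j) + vsum l b = (m./2)%:Z %[mod n])%Z.
Proof.
move=> m2 /closed_coloring_petersen H.
have odd1 : odd (1%R : 'Z_m) by rewrite -[1%R]mulr1n val_Zp_nat // modn_small.
have oddj : odd (j%:R%R : 'Z_m) = odd j 
  by rewrite val_Zp_nat // odd_mod //; apply/negbTE; rewrite -dvdn2.
split; rewrite -(sum1_parity b m2).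
  rewrite -(sum_eqz_mod _ (fun i => proj1 (H i))) !big_split /=.
  rewrite !(@sum_shift (fun i => l (inl i))) // odd_Zp_opp // odd1.
  by rewrite -/(vsum l _) -/(vsum l _) -/(usum l _) addbT; congr (_ %% _)%Z; ring.
rewrite -(sum_eqz_mod _ (fun i => proj2 (H i))) !big_split /=.
rewrite !(@sum_shift (fun i => l (inr i))) // odd_Zp_opp // oddj.
by rewrite -/(vsum l _) -/(usum l _) -/(usum l _); congr (_ %% _)%Z; ring.
Qed.

(** If V and U are the total labels of the two kinds of vertices, then 3V + U = m and 3U + V = m mod
    4; adding gives 2m = 0 mod 4. *)
Lemma even_of_closed_coloring_mod4 (l : petersen_vertex m -> int) :
  closed_coloring (petersen m j) 4 1%R l -> 2 %| m.
Proof.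
move=> /closed_coloring_petersen H.
have shift (f : 'Z_m -> int) (c : 'Z_m) : (\sum_i f (i + c) = \sum_i f i)%R.
  by rewrite [RHS](reindex_inj (addIr c)).
have := sum_eqz_mod xpredT (fun i => proj1 (H i)).
have := sum_eqz_mod xpredT (fun i => proj2 (H i)).
rewrite !big_split /= !(shift (fun i => l (inl i))) !(shift (fun i => l (inr i))).
rewrite sumr_const card_ord; move: (\sum_i l (inl i))%R (\sum_i l (inr i))%R => v u.
by rewrite Zp_cast // natz; lia.
Qed.

End Petersen.

Theorem theorem7p1 (n m j : nat) (hn : 0 < n) (hm : 3 <= m)
    (hj : 1 <= j) (hjm : 2 * j < m) :
  (~~ (4 %| n) -> chi_exists (petersen m j) n 1%R) /\
  (4 %| n -> ~~ (2 %| m) -> ~ chi_exists (petersen m j) n 1%R) /\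
  (4 %| n -> 2 %| m -> ~~ (2 %| j) ->
     (chi_exists (petersen m j) n 1%R <-> 4 %| m)) /\
  (4 %| n -> ~~ (8 %| n) -> 2 %| m -> 2 %| j ->
     chi_exists (petersen m j) n 1%R) /\
  (8 %| n -> 2 %| m -> ~~ (4 %| m) -> 2 %| j ->
     ~ chi_exists (petersen m j) n 1%R) /\
  (16 %| n -> 4 %| m -> ~~ (8 %| m) -> 2 %| j ->
     ~ chi_exists (petersen m j) n 1%R).
Proof.
have parity d l b : d %| n -> 2 %| m -> closed_coloring (petersen m j) n 1%R l ->
  exists q r : int,
    (vsum l b + 2 * vsum l (~~ b) + usum l b = (m./2)%:Z + q * d%:Z)%R /\
    (usum l b + 2 * usum l (b (+) odd j) + vsum l b = (m./2)%:Z + r * d%:Z)%R.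
  move=> dn m2 /(closed_coloring_dvd dn) /(sum_parity_classes hm hj hjm b m2) [].
  move=> /eqP; rewrite eqz_mod_dvd => /dvdzP[q Hq].
  move=> /eqP; rewrite eqz_mod_dvd => /dvdzP[r Hr].
  by exists q, r; split; [move: Hq|move: Hr]; lia.
split=> [n4|].
  have [n_odd|n_even] := boolP (odd n).
    (* For odd [n], (n + 1)/2 inverts 2 mod [n], so its square inverts 4. *)
    pose c : int := ((n./2 + 1) * (n./2 + 1))%N.
    have e : (3 * c + c = (n%:Z + 2) * n%:Z + 1)%R.
      have en : n = (n./2 + n./2 + 1)%N by lia.
      by rewrite /c; move: (n./2) en => t ->; rewrite !PoszM !PoszD; ring.
    by apply: (@constant_chi_exists _ _ _ _ _ n 1%R c c) => //; rewrite e modzMDl.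
  have half_odd : odd n./2 by lia.
  have [x [y [q [r [Hx Hy]]]]] := double_odd_system half_odd.
  rewrite (_ : 2 * n./2 = n)%N in Hx Hy; last by lia.
  by apply: (@constant_chi_exists _ _ _ _ _ n 1%R x y) => //;
    rewrite ?Hx ?Hy addrC modzMDl.
split=> [n4 m2 [l [_ Hl]]|].
  by rewrite (even_of_closed_coloring_mod4 hm hj hjm (closed_coloring_dvd n4 Hl)) in m2.
split=> [n4 m2 j2|].
  have j_odd : odd j by rewrite dvdn2 negbK in j2.
  split=> [[l [_ Hl]]|m4].
    (* Write V_b, U_b for the class sums and h = m/2. For odd [j], the two congruences of one class
       differ by 2V - 2U of the other class, where V and U thus have equal parity; there V + U = h
       mod 2 makes h even. *)
    have [q1 [r1 [Hq1 Hr1]]] := parity 4 l true n4 m2 Hl.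
    have [q0 [r0 [Hq0 Hr0]]] := parity 4 l false n4 m2 Hl.
    rewrite j_odd /= in Hr0 Hr1; rewrite /= in Hq0 Hq1; lia.
  (* The [v_i] with [i = 0 %[mod 4]] and the [u_i] with [i = 2 %[mod 4]] form a
     perfect dominating set: each closed neighborhood contains exactly one. *)
  pose lab r (x : nat) : int := (x %% 4 == r)%N.
  apply: (@periodic_chi_exists _ _ _ _ _ n 4 1%R (lab 0) (lab 2)) => //; rewrite /lab.
  - by move=> x y ->.
  - by move=> x y ->.
  - by move=> x; congr (_ %% _)%Z; lia.
  - by move=> x; congr (_ %% _)%Z; lia.
split=> [n4 n8 m2 j2|].
  have quarter_odd : odd (n %/ 4) by lia.
  have [x [y [q [r [Hx Hy]]]]] := double_odd_system quarter_odd.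
  have en : (n%:Z = 2 * (2 * (n %/ 4))%N%:Z)%R by lia.
  pose u i : int := if odd i then y else x.
  (* For even [j] the label 1 - 3u on the outer vertices makes the sums around the inner ones
     exactly 1. The outer sums then require 2(3x + y) = 2 and 2(3y + x) = 2 mod [n], which is the
     system solved modulo n/2. *)
  apply: (@periodic_chi_exists _ _ _ _ _ n 2 1%R (fun i => 1 - 3 * u i)%R u) => //.
  - by move=> a b; rewrite /u !modn2; case: (odd a); case: (odd b).
  - by move=> a b; rewrite /u !modn2; case: (odd a); case: (odd b).
  - move=> a; rewrite /u !oddD; case: (odd a) => /=.
      have -> : (1 - 3 * y + (1 - 3 * x) + (1 - 3 * y) + x = - r * n%:Z + 1)%R.
        by rewrite en; lia.
      by rewrite modzMDl.
    have -> : (1 - 3 * x + (1 - 3 * y) + (1 - 3 * x) + y = - q * n%:Z + 1)%R.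
      by rewrite en; lia.
    by rewrite modzMDl.
  - have /negbTE j_even : ~~ odd j by rewrite -dvdn2.
    by move=> a; rewrite /u !oddD j_even !addbF; congr (_ %% _)%Z; ring.
split=> [n8 m2 m4 j2 [l [_ Hl]]|n16 m4 m8 j2 [l [_ Hl]]].
  (* For even [j], V_b = h - 3U_b mod 8. Eliminating V leaves U_b + 3U_{1-b} = h mod 4 for both b;
     adding these gives 2h = 0 mod 4, so 4 divides [m]. *)
  have [q1 [r1 [Hq1 Hr1]]] := parity 8 l true n8 m2 Hl.
  have [q0 [r0 [Hq0 Hr0]]] := parity 8 l false n8 m2 Hl.
  have /negbTE j_even : ~~ odd j by rewrite -dvdn2.
  rewrite j_even /= in Hr0 Hr1; rewrite /= in Hq0 Hq1; lia.
have m2 : 2 %| m by lia.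
(* The same elimination gives U_b + 3U_{1-b} = h mod 8. The difference yields U_0 = U_1 mod 4, so
   the sum 2h = 4(U_0 + U_1) vanishes mod 8 and 8 divides [m]. *)
have [q1 [r1 [Hq1 Hr1]]] := parity 16 l true n16 m2 Hl.
have [q0 [r0 [Hq0 Hr0]]] := parity 16 l false n16 m2 Hl.
have /negbTE j_even : ~~ odd j by rewrite -dvdn2.
rewrite j_even /= in Hr0 Hr1; rewrite /= in Hq0 Hq1; lia.
Qed.
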